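(* Let $G$ be a (not necessarily finitely generated) group hyperbolic relative to a collection of subgroups $\{H_\lambda\}_{\lambda\in\Lambda}$. If $G$ is residually finite and all subgroups $H_\lambda$ are torsion free, then $G$ is virtually torsion free, that is, $G$ contains a torsion free subgroup of finite index.
   Context: Relative hyperbolicity. A subset $X\subseteq G$ is a relative generating set of $G$ with respect to $\{H_\lambda\}_{\lambda\in\Lambda}$ if $G$ is generated by $X\cup\bigcup_{\lambda}H_\lambda$. Put $F=(\ast_{\lambda\in\Lambda}\widetilde H_\lambda)\ast F(X)$, where $\widetilde H_\lambda$ is an isomorphic copy of $H_\lambda$ and $F(X)$ is free with basis $X$, and $\mathcal H=\bigsqcup_{\lambda\in\Lambda}(\widetilde H_\lambda\setminus\{1\})$. A finite relative presentation $\langle X,H_\lambda,\lambda\in\Lambda\mid R=1,R\in\mathcal R\rangle$ of $G$ consists of a finite relative generating set $X$ and a finite set $\mathcal R$ of words over $X^{\pm1}\cup\mathcal H$ (closed under cyclic shifts and inverses) whose normal closure in $F$ is the kernel of the canonical epimorphism $F\to G$. Its relative Dehn function is the smallest function $f$ such that every word $W$ over $X^{\pm1}\cup\mathcal H$ of length at most $n$ representing $1$ in $G$ equals in $F$ a product $\prod_{i=1}^kf_i^{-1}R_if_i$ with $R_i\in\mathcal R$, $f_i\in F$, $k\le f(n)$. $G$ is hyperbolic relative to $\{H_\lambda\}_{\lambda\in\Lambda}$ if it has a finite relative presentation whose relative Dehn function is bounded from above by $Ln$ for some constant $L$. *)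

(* Defs.v *)
From HB Require Import structures.
From mathcomp Require Import all_boot fingroup generic_quotient.
From mathcomp Require Import boolp classical_sets cardinality.

Set Implicit Arguments.
Unset Strict Implicit.
Unset Printing Implicit Defensive.

Local Open Scope classical_set_scope.
Local Open Scope group_scope.

(* Subgroups of a possibly infinite group are bundled boolean predicates
   [groupClosed G]; since excluded middle holds, every subgroup is one. *)

Definition subgroup_type (G : groupType) (A : groupClosed G) : Type :=
  {x : G | x \in A}.

Section SubgroupType.
Variables (G : groupType) (A : groupClosed G).

HB.instance Definition _ := SubChoice.on (subgroup_type A).

Fact subgroup_type_closed : group_closed A.
Proof. by split; [exact: gpred1 | exact: gpredF]. Qed.

HB.instance Definition _ :=
  SubChoice_isSubGroup.Build G (fun x => x \in A) (subgroup_type A)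
    subgroup_type_closed.

End SubgroupType.

Definition torsion_free (G : groupType) :=
  forall (g : G) (n : nat), 0 < n -> g ^+ n = 1 -> g = 1.

Definition finite_index (G : groupType) (A : groupClosed G) :=
  finite_set (range (fun g : G => [set g * a | a in [set` A]])).

Definition virtually_torsion_free (G : groupType) :=
  exists A : groupClosed G, finite_index A /\ torsion_free (subgroup_type A).

Definition residually_finite (G : groupType) :=
  forall g : G, g <> 1 ->
    exists (Q : finGroupType) (phi : {multiplicative G -> Q}), phi g <> 1.

Definition generates (G : groupType) (S : set G) :=
  forall A : groupClosed G, S `<=` [set` A] -> forall g, g \in A.

Definition normal_closure (G : groupType) (S : set G) : set G :=
  [set g | forall N : groupClosed G, S `<=` [set` N] ->
     (forall x y, x \in N -> x ^ y \in N) -> g \in N].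

(* The free product of the groups [K l] and of the free group with basis [X]:
   words in letters [k : K l] and [x^(+/-1)], modulo the congruence generated
   by the multiplication tables of the [K l] and free cancellation.  The
   letters [1 : K l] are available here and are equal to the empty word. *)

Section FreeProduct.
Variables (L : Type) (K : L -> groupType) (X : Type).

(* [Gen x true] is x and [Gen x false] is its inverse. *)
Inductive letter := Per (l : L) (k : K l) | Gen (x : X) (b : bool).

Definition word := seq letter.

HB.instance Definition _ := gen_eqMixin letter.
HB.instance Definition _ := gen_choiceMixin letter.
HB.instance Definition _ := Choice.on word.

Definition inv_letter (a : letter) : letter :=
  match a with Per l k => Per k^-1 | Gen x b => Gen x (~~ b) end.

Definition inv_word (w : word) : word := rev (map inv_letter w).

Inductive word_cong : word -> word -> Prop :=
| cong_one l : word_cong [:: Per (1 : K l)] [::]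
| cong_mul l (h k : K l) : word_cong [:: Per h; Per k] [:: Per (h * k)]
| cong_cancel x b : word_cong [:: Gen x b; Gen x (~~ b)] [::]
| cong_refl u : word_cong u u
| cong_sym u v : word_cong u v -> word_cong v u
| cong_trans u v w : word_cong u v -> word_cong v w -> word_cong u w
| cong_cat u u' v v' :
    word_cong u u' -> word_cong v v' -> word_cong (u ++ v) (u' ++ v').

Definition word_congb (u v : word) : bool := `[< word_cong u v >].

Fact word_congb_refl : reflexive word_congb.
Proof. by move=> u; apply/asboolP; exact: cong_refl. Qed.

Fact word_congb_sym : symmetric word_congb.
Proof. by move=> u v; apply/asboolP/asboolP; exact: cong_sym. Qed.

Fact word_congb_trans : transitive word_congb.
Proof.
by move=> v u w /asboolP uv /asboolP vw; apply/asboolP; exact: cong_trans uv vw.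
Qed.

Canonical word_congb_equiv :=
  EquivRel word_congb word_congb_refl word_congb_sym word_congb_trans.

Definition free_product := {eq_quot word_congb}%qT.

HB.instance Definition _ := Choice.on free_product.

Definition word_class (w : word) : free_product := (\pi_{eq_quot word_congb} w)%qT.

Lemma word_classP u v : word_class u = word_class v <-> word_cong u v.
Proof.
by split=> [/eqmodP/asboolP //|uv]; apply/eqmodP/asboolP.
Qed.

Lemma word_classK (f : free_product) : word_class (repr f) = f.
Proof. exact: reprK. Qed.

Lemma cong_repr w : word_cong (repr (word_class w)) w.
Proof. by apply/word_classP; rewrite word_classK. Qed.

Lemma inv_letterK : involutive inv_letter.
Proof. by case=> [l k|x b] /=; rewrite ?invgK ?negbK. Qed.

Lemma inv_wordK : involutive inv_word.
Proof. by move=> w; rewrite /inv_word map_rev revK mapK //; exact: inv_letterK. Qed.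

Lemma inv_word_cat u v : inv_word (u ++ v) = inv_word v ++ inv_word u.
Proof. by rewrite /inv_word map_cat rev_cat. Qed.

Lemma cong_mulV w : word_cong (w ++ inv_word w) [::].
Proof.
elim: w => [|a w IHw]; first exact: cong_refl.
rewrite -cat1s inv_word_cat -catA [w ++ _]catA.
have aV : word_cong ([:: a] ++ [:: inv_letter a]) [::].
  case: a => [l k|x b]; last exact: cong_cancel.
  by apply: cong_trans (cong_mul _ _) _; rewrite mulgV; exact: cong_one.
apply: cong_trans aV; apply: cong_cat; first exact: cong_refl.
rewrite -[X in word_cong _ X]cat0s.
by apply: cong_cat; [exact: IHw | exact: cong_refl].
Qed.

Lemma cong_inv u v : word_cong u v -> word_cong (inv_word u) (inv_word v).
Proof.
move=> uv; rewrite -[inv_word u]cats0 -[inv_word v]cat0s.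
apply: (@cong_trans _ (inv_word u ++ (v ++ inv_word v))).
  by apply: cong_cat; [exact: cong_refl | apply: cong_sym; exact: cong_mulV].
rewrite catA; apply: cong_cat; last exact: cong_refl.
apply: (@cong_trans _ (inv_word u ++ u)).
  by apply: cong_cat; [exact: cong_refl | exact: cong_sym].
by rewrite -{2}[u]inv_wordK; exact: cong_mulV.
Qed.

Definition fp_mul (f g : free_product) : free_product :=
  word_class (repr f ++ repr g).
Definition fp_one : free_product := word_class [::].
Definition fp_inv (f : free_product) : free_product :=
  word_class (inv_word (repr f)).

Fact fp_mulA : associative fp_mul.
Proof.
move=> f g h; apply/word_classP.
apply: (@cong_trans _ (repr f ++ (repr g ++ repr h))).
  by apply: cong_cat; [exact: cong_refl | exact: cong_repr].
rewrite catA; apply: cong_cat; last exact: cong_refl.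
by apply: cong_sym; exact: cong_repr.
Qed.

Fact fp_mul1 : left_id fp_one fp_mul.
Proof.
move=> f; rewrite -[RHS]word_classK; apply/word_classP.
rewrite -[X in word_cong _ X]cat0s.
by apply: cong_cat; [exact: cong_repr | exact: cong_refl].
Qed.

Fact fp_mulr1 : right_id fp_one fp_mul.
Proof.
move=> f; rewrite -[RHS]word_classK; apply/word_classP.
rewrite -[X in word_cong _ X]cats0.
by apply: cong_cat; [exact: cong_refl | exact: cong_repr].
Qed.

Fact fp_mulV : left_inverse fp_one fp_inv fp_mul.
Proof.
move=> f; apply/word_classP.
apply: (@cong_trans _ (inv_word (repr f) ++ repr f)).
  by apply: cong_cat; [exact: cong_repr | exact: cong_refl].
by rewrite -{2}[repr f]inv_wordK; exact: cong_mulV.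
Qed.

Fact fp_mulgV : right_inverse fp_one fp_inv fp_mul.
Proof.
move=> f; apply/word_classP.
apply: (@cong_trans _ (repr f ++ inv_word (repr f))).
  by apply: cong_cat; [exact: cong_refl | exact: cong_repr].
exact: cong_mulV.
Qed.

HB.instance Definition _ :=
  isGroup.Build free_product fp_mulA fp_mul1 fp_mulr1 fp_mulV fp_mulgV.

Lemma word_class_cat u v : word_class (u ++ v) = word_class u * word_class v.
Proof.
apply/word_classP; apply: cong_sym.
by apply: cong_cat; exact: cong_repr.
Qed.

Lemma word_class_nil : word_class [::] = 1.
Proof. by []. Qed.

Lemma word_class_inv w : word_class (inv_word w) = (word_class w)^-1.
Proof. by apply/word_classP/cong_inv/cong_sym; exact: cong_repr. Qed.

Section Lift.
Variables (T : groupType) (phi : forall l, {multiplicative K l -> T}).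
Variable xi : X -> T.

Definition letter_val (a : letter) : T :=
  match a with
  | Per l k => phi l k
  | Gen x b => if b then xi x else (xi x)^-1
  end.

Definition word_val (w : word) : T := \prod_(a <- w) letter_val a.

Definition fp_lift (f : free_product) : T := word_val (repr f).

Lemma word_val_cat u v : word_val (u ++ v) = word_val u * word_val v.
Proof. exact: big_cat. Qed.

Lemma word_val_cong u v : word_cong u v -> word_val u = word_val v.
Proof.
elim=> [l|l h k|x b|//|//|? ? ? _ -> _ -> //|u1 u2 v1 v2 _ e1 _ e2].
- rewrite /word_val big_seq1 big_nil /=.
  by apply: (mulgI (phi l 1)); rewrite mulg1 -gmulfM mulg1.
- by rewrite /word_val big_cons !big_seq1 /= gmulfM.
- rewrite /word_val big_cons big_seq1 big_nil /=.
  by case: b; rewrite /= ?mulgV ?mulVg.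
- by rewrite !word_val_cat e1 e2.
Qed.

Lemma fp_lift_class w : fp_lift (word_class w) = word_val w.
Proof. exact/word_val_cong/cong_repr. Qed.

Fact fp_liftM : {morph fp_lift : f g / f * g}.
Proof.
move=> f g; rewrite -[f]word_classK -[g]word_classK -word_class_cat.
by rewrite !fp_lift_class word_val_cat.
Qed.

HB.instance Definition _ := isMultiplicative.Build free_product T fp_lift fp_liftM.

Lemma fp_lift_per l (k : K l) : fp_lift (word_class [:: Per k]) = phi l k.
Proof. by rewrite fp_lift_class /word_val big_seq1. Qed.

Lemma fp_lift_gen x : fp_lift (word_class [:: Gen x true]) = xi x.
Proof. by rewrite fp_lift_class /word_val big_seq1. Qed.

Lemma fp_lift_unique (psi : {multiplicative free_product -> T}) :
  (forall l (k : K l), psi (word_class [:: Per k]) = phi l k) ->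
  (forall x, psi (word_class [:: Gen x true]) = xi x) ->
  psi =1 fp_lift.
Proof.
move=> psiP psiX f; rewrite -[f]word_classK fp_lift_class.
have psi1 : psi 1 = 1 by apply: (mulgI (psi 1)); rewrite mulg1 -gmulfM mulg1.
elim: (repr f) => [|a w IHw]; first by rewrite /word_val big_nil.
rewrite -cat1s word_class_cat gmulfM IHw word_val_cat; congr (_ * _).
rewrite /word_val big_seq1; case: a => [l k|x [|]] //=.
apply: (mulgI (xi x)); rewrite mulgV -psiX -gmulfM -word_class_cat.
by rewrite -psi1; congr (psi _); apply/word_classP; exact: (cong_cancel x true).
Qed.

End Lift.
End FreeProduct.

Section RelativePresentation.
Variables (G : groupType) (L : Type) (H : L -> groupClosed G) (X : set G).

Definition peripheral (l : L) : groupType := subgroup_type (H l).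

Definition rel_free : groupType := free_product peripheral X.

Definition rel_word := word peripheral X.

Definition rel_class (w : rel_word) : rel_free := word_class w.

(* Words over X^(+/-1) and the disjoint union of the H_l \ {1}. *)
Definition admissible (w : rel_word) : Prop :=
  forall l (h : peripheral l), Per X h \in w -> h <> 1.

Definition peripheral_incl (l : L) : {multiplicative peripheral l -> G} :=
  (val : subgroup_type (H l) -> G).

Definition canonical_epi : rel_free -> G :=
  fp_lift peripheral_incl (fun x : X => val x).

Definition rel_generating :=
  generates (X `|` \bigcup_l [set` H l]).

Definition finite_rel_presentation (R : set rel_word) : Prop :=
  [/\ finite_set X, rel_generating, finite_set R &
   [/\ forall w, R w -> admissible w,
       forall n w, R w -> R (rot n w),
       forall w, R w -> R (inv_word w) &
       normal_closure (rel_class @` R) = [set f | canonical_epi f = 1]]].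

(* [w] equals in F a product of at most [n] conjugates of elements of [R]. *)
Definition rel_area_le (R : set rel_word) (w : rel_word) (n : nat) : Prop :=
  exists s : seq (rel_word * rel_free),
    [/\ size s <= n, forall p, p \in s -> R p.1 &
        rel_class w = \prod_(p <- s) rel_class p.1 ^ p.2].

Definition rel_isoperimetric (R : set rel_word) (f : nat -> nat) : Prop :=
  forall n w, admissible w -> size w <= n -> canonical_epi (rel_class w) = 1 ->
    rel_area_le R w (f n).

Definition rel_dehn_function (R : set rel_word) (f : nat -> nat) : Prop :=
  rel_isoperimetric R f /\
  forall g, rel_isoperimetric R g -> forall n, f n <= g n.

End RelativePresentation.

Definition relatively_hyperbolic (G : groupType) (L : Type)
    (H : L -> groupClosed G) : Prop :=
  exists (X : set G) (R : set (rel_word H X)),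
    finite_rel_presentation R /\
    exists f : nat -> nat, rel_dehn_function R f /\
      exists C : nat, forall n, f n <= C * n.

(* Main.v *)
(* Every nontrivial torsion element g has a power conjugate into a fixed finite
   set T of nontrivial elements; a finite quotient of G in which no element of T
   dies then has a torsion-free kernel.

   Among the conjugates of nontrivial powers of g choose gam of least length k
   for the generators X and the H_l, spelled by w, and let n be its order.  The
   closed path w^n is geodesic on segments of length k.  Instead of van Kampen
   diagrams, areas are bounded from below by duality: a cochain on the edges of
   the relative Cayley graph which respects the relations of F has the same
   integral over a loop as over the relators filling it.

   k is bounded: take a shortest subpath, of length D > k, whose endpoints are
   at distance at most 8q, where q is proportional to k.  For a vertex p of it,
   the cochain (2q - d(p, .)) df, f being the distance to the vertex 2q edges
   before p, integrates to at least q^2, and is bounded on relators.  Summing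
   over p, a filling needs of the order of Dq relators, against the at most
   C(D + 8q) allowed by the linear Dehn function.

   The letters of w are bounded: all peripheral letters of w^n lie in distinct
   cosets, so a cochain measuring each of them by its length with respect to
   the finite set Omega of letters of relators gives n times the total length of
   w on the loop, and at most the length of a relator on each relator.  Since
   the area is at most Cnk, the factor n cancels. *)
Require Import Defs.
From mathcomp Require Import all_boot.
From HB Require Import structures.
From mathcomp Require Import fingroup perm gproduct.
From mathcomp Require Import order ssralg ssrnum ssrint zify ring.
From mathcomp Require Import generic_quotient boolp classical_sets cardinality.

Set Implicit Arguments.
Unset Strict Implicit.
Unset Printing Implicit Defensive.

Local Open Scope classical_set_scope.
Local Open Scope group_scope.

(** * Word length and the word metric of a generating set *)

Section WordLength.
Variables (G : groupType) (S : set G).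

Fixpoint ball (n : nat) : set G :=
  if n is m.+1 then ball m `|` [set x * s | x in ball m & s in S]
  else [set 1].

Lemma ball_le m n : (m <= n)%N -> ball m `<=` ball n.
Proof.
elim: n => [|n IHn]; first by rewrite leqn0 => /eqP ->.
by rewrite leq_eqVlt ltnS => /orP[/eqP -> //|/IHn mn x /mn ?]; left.
Qed.

Lemma ball_gen s : S s -> ball 1 s.
Proof. by move=> Ss; right; exists 1 => //; exists s => //; rewrite mul1g. Qed.

Lemma ballM m n x y : ball m x -> ball n y -> ball (m + n) (x * y).
Proof.
move=> mx; elim: n y => [|n IHn] y /=; first by move=> ->; rewrite addn0 mulg1.
rewrite addnS => -[/IHn ?|[z /IHn zn [s Ss <-]]]; first by left.
by right; exists (x * z) => //; exists s => //; rewrite mulgA.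
Qed.

Lemma finite_ball n : finite_set S -> finite_set (ball n).
Proof.
move=> finS; elim: n => [|n IHn] /=; first exact: finite_set1.
by rewrite finite_setU; split=> //; exact: finite_image2.
Qed.

(* The junk value [d] is taken outside the subgroup generated by [S]. *)
Definition word_length (d : nat) (g : G) : nat :=
  if pselect (exists n, `[< ball n g >]) is left e then ex_minn e else d.

Lemma word_length_le d n g : ball n g -> (word_length d g <= n)%N.
Proof.
rewrite /word_length => gn; case: pselect => [e|[]]; last first.
  by exists n; apply/asboolP.
by case: ex_minnP => m _; apply; apply/asboolP.
Qed.

Lemma word_lengthP d n g : ball n g -> ball (word_length d g) g.
Proof.
rewrite /word_length => gn; case: pselect => [e|[]]; last first.
  by exists n; apply/asboolP.
by case: ex_minnP => m /asboolP.
Qed.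

(** A value below the junk value [d] can only be a genuine length. *)
Lemma word_length_lt d g : (word_length d g < d)%N -> ball (word_length d g) g.
Proof.
rewrite /word_length; case: pselect => [e|]; last by rewrite ltnn.
by case: ex_minnP => m /asboolP.
Qed.

Lemma word_length1 d : word_length d 1 = 0%N.
Proof. by apply/eqP; rewrite -leqn0; apply: word_length_le. Qed.

Hypothesis symS : forall s, S s -> S s^-1.

Lemma ballV n x : ball n x -> ball n x^-1.
Proof.
elim: n x => [|n IHn] x /=; first by move=> ->; rewrite invg1.
move=> [/IHn|[y /IHn yn [s Ss <-]]]; first by left.
by rewrite invgM; apply: (@ballM 1 n) => //; exact/ball_gen/symS.
Qed.

(** As [S] is symmetric, [g] and [g * s] lie both inside or both outside the union of the balls, so
    the junk value [d] does no harm. *)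
Lemma word_length_Mgen d g s : S s ->
  (word_length d (g * s) <= (word_length d g).+1)%N.
Proof.
move=> Ss; have [[n gn]|ng] := EM (exists n, ball n g).
  apply: word_length_le; rewrite -addn1.
  exact: ballM (word_lengthP d gn) (ball_gen Ss).
rewrite /word_length; case: pselect => [e|_].
  have [n /asboolP gsn] := e; exfalso; apply: ng; exists (n + 1)%N.
  rewrite -(mulgK s g).
  exact: ballM gsn (ball_gen (symS Ss)).
case: pselect => // e; have [n /asboolP gn] := e.
by case: ng; exists n.
Qed.

Lemma word_length_lipschitz d g s : S s ->
  (`|Posz (word_length d (g * s)%g) - Posz (word_length d g)| <= 1)%R.
Proof.
move=> Ss; have := word_length_Mgen d g Ss.
have : (word_length d g <= (word_length d (g * s)).+1)%N.
  by rewrite -{1}(mulgK s g); exact/word_length_Mgen/symS.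
lia.
Qed.

Hypothesis genS : forall g, exists n, ball n g.

Let len := word_length 0.

Lemma ball_len g : ball (len g) g.
Proof. have [n gn] := genS g; exact: word_lengthP gn. Qed.

Lemma lenM x y : (len (x * y) <= len x + len y)%N.
Proof. apply: word_length_le; apply: ballM; exact: ball_len. Qed.

Lemma lenV x : len x^-1 = len x.
Proof.
have le z : (len z^-1 <= len z)%N by exact: word_length_le (ballV (ball_len z)).
by apply/eqP; rewrite eqn_leq le -{1}[x]invgK le.
Qed.

Definition dist (x y : G) : nat := len (x^-1 * y).

Lemma distxx x : dist x x = 0%N.
Proof. by rewrite /dist mulVg; exact: word_length1. Qed.

Lemma distC x y : dist x y = dist y x.
Proof. by rewrite /dist -lenV invgM invgK. Qed.

Lemma dist_triangle y x z : (dist x z <= dist x y + dist y z)%N.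
Proof.
by apply: leq_trans (lenM _ _); rewrite mulgA mulgK.
Qed.

Lemma dist_gen x s : S s -> (dist x (x * s) <= 1)%N.
Proof.
by move=> Ss; rewrite /dist mulKg; exact: word_length_le (ball_gen Ss).
Qed.

End WordLength.

(** * Cochains on the relative Cayley graph and areas *)

Section Cochains.
Variables (G : groupType) (L : Type) (H : L -> groupClosed G) (X : set G).

Local Notation letter := (letter (peripheral H) X).
Local Notation word := (rel_word H X).

Definition lval (a : letter) : G :=
  letter_val (peripheral_incl H) (fun x : X => val x) a.
Definition wval (w : word) : G :=
  word_val (peripheral_incl H) (fun x : X => val x) w.

Lemma wval_nil : wval [::] = 1.
Proof. exact: big_nil. Qed.

Lemma wval_cons a w : wval (a :: w) = lval a * wval w.
Proof. exact: big_cons. Qed.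

Lemma mulg_wval_cons y a w : y * wval (a :: w) = y * lval a * wval w.
Proof. by rewrite wval_cons mulgA. Qed.

Lemma wval_cat u v : wval (u ++ v) = wval u * wval v.
Proof. exact: word_val_cat. Qed.

Lemma wval_cong u v : word_cong u v -> wval u = wval v.
Proof. exact: word_val_cong. Qed.

Lemma canonical_epiE w : canonical_epi (rel_class w) = wval w.
Proof. exact: fp_lift_class. Qed.

Lemma lval_inv a : lval (inv_letter a) = (lval a)^-1.
Proof. by case: a => [l k|x []]; rewrite /lval /= ?gmulfV ?invgK. Qed.

Lemma lval_genN (x : X) b :
  lval (Gen _ x (~~ b)) = (lval (Gen _ x b))^-1.
Proof. exact: (lval_inv (Gen _ x b)). Qed.

Lemma wval_inv w : wval (inv_word w) = (wval w)^-1.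
Proof.
apply: (mulgI (wval w)); rewrite -wval_cat mulgV (wval_cong (cong_mulV w)).
exact: wval_nil.
Qed.

Lemma lval_perM l (h k : peripheral H l) :
  lval (Per X (h * k)) = lval (Per X h) * lval (Per X k).
Proof. by []. Qed.

(* [E y a] is the value on the edge of the relative Cayley graph from [y]
   labelled [a]; the two conditions make [integral E y w] depend only on [y]
   and on the element of the free product F represented by [w]. *)
Definition cochain (E : G -> letter -> int) : Prop :=
  (forall y l (h k : peripheral H l),
     E y (Per X (h * k)) =
     (E y (Per X h) + E (y * lval (Per X h))%g (Per X k))%R) /\
  (forall y x b,
     (E y (Gen _ x b) + E (y * lval (Gen _ x b))%g (Gen _ x (~~ b)))%R = 0%R).

Fixpoint integral (E : G -> letter -> int) (y : G) (w : word) : int :=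
  if w is a :: v then (E y a + integral E (y * lval a)%g v)%R else 0%R.

Lemma integral_cat E y u v :
  integral E y (u ++ v) = (integral E y u + integral E (y * wval u)%g v)%R.
Proof.
elim: u y => [|a u IHu] y /=; first by rewrite wval_nil mulg1 GRing.add0r.
by rewrite IHu mulg_wval_cons GRing.addrA.
Qed.

Lemma integral_cong E u v : cochain E -> word_cong u v ->
  forall y, integral E y u = integral E y v.
Proof.
move=> [EM EV].
elim=> [l|l h k|x b|?|?? _ e1|??? _ e1 _ e2|u1 u2 v1 v2 uv1 e1 _ e2] y /=.
(* At [1 * 1] the first cochain condition makes the value on an identity letter equal to its double,
   hence zero. *)
- have := EM y l 1 1; rewrite mulg1 (_ : lval _ = 1) // mulg1; lia.
- by rewrite EM GRing.addrA.
- by rewrite !GRing.addr0 EV.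
- by [].
- by rewrite e1.
- by rewrite e1 e2.
- by rewrite !integral_cat e1 e2 (wval_cong uv1).
Qed.

(** A conjugate of a relator follows a path, runs round the relator and returns; the two passages
    along the path cancel. The base points [p.1] do not depend on the cochain, so one filling serves
    a whole family of cochains. *)
Lemma area_decomposition (R : set word) w n :
  (forall r, R r -> wval r = 1) -> rel_area_le R w n ->
  exists s : seq (G * word),
    [/\ (size s <= n)%N, forall p, p \in s -> R p.2 &
        forall E y, cochain E ->
          integral E y w = (\sum_(p <- s) integral E (y * p.1)%g p.2)%R].
Proof.
move=> R1 [s [sn sR sw]].
suff [t [st tR tw]] : exists t : seq (G * word),
    [/\ size t = size s, forall p, p \in t -> R p.2 &
        forall E y, cochain E ->
          integral E y w = (\sum_(p <- t) integral E (y * p.1)%g p.2)%R].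
  by exists t; rewrite st.
elim: s w sR sw {sn} => [|[r f] s IHs] w sR;
  rewrite ?big_nil ?big_cons /= => sw.
  exists [::]; split=> // E y cE; rewrite big_nil.
  by have /word_classP/(integral_cong cE) -> := sw.
set w' := repr (\prod_(j <- s) rel_class j.1 ^ j.2).
have [|t [st tR tw]] := IHs w' _ (word_classK _).
  by move=> p ps; apply: sR; rewrite inE ps orbT.
have rR : R r by apply: (sR (r, f)); rewrite inE eqxx.
exists ((wval (inv_word (repr f)), r) :: t); split=> [|p|E y cE].
- by rewrite /= st.
- by rewrite inE => /orP[/eqP -> //|/tR].
have /word_classP/(integral_cong cE) -> :
    rel_class w = rel_class ((inv_word (repr f) ++ r ++ repr f) ++ w').
  by rewrite sw /rel_class !word_class_cat word_class_inv !word_classK -mulgA.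
rewrite big_cons !integral_cat -tw // !wval_cat (R1 _ rR).
rewrite mul1g wval_inv mulVg mulg1.
congr (_ + _)%R; last by rewrite mulg1.
have := integral_cat E y (inv_word (repr f)) (repr f).
rewrite (integral_cong cE (v := [::])) /= ?wval_inv; first by lia.
by rewrite -{2}[repr f]inv_wordK; exact: cong_mulV.
Qed.

End Cochains.

Arguments lval : simpl never.
(** All nonzero terms fit into a window of [T.+1] indices that starts at the first of them. *)
Lemma sum_window (F : nat -> int) (B T x y : nat) :
  (forall m, F m <= B%:Z)%R ->
  (forall m n, (x <= m)%N -> (m <= n)%N -> (n < y)%N ->
     F m <> 0%R -> F n <> 0%R -> (n <= m + T)%N) ->
  (\sum_(x <= m < y) F m <= (B * T.+1)%N%:Z)%R.
Proof.
move=> FB.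
have le s n : (\sum_(s <= m < s + n) F m <= (B * n)%N%:Z)%R.
  elim: n => [|n IHn]; first by rewrite addn0 big_geq.
  rewrite addnS big_nat_recr ?leq_addr //= mulnSr PoszD.
  exact: Num.Theory.lerD.
have [xy|yx] := leqP x y; last by rewrite big_geq ?(ltnW yx).
rewrite -(subnKC xy); move: (y - x)%N => n; elim: n x {xy} => [|n IHn] x FT.
  by rewrite addn0 big_geq.
have [Fx|Fx] := EM (F x = 0%R).
  rewrite big_ltn; last by rewrite addnS ltnS leq_addr.
  rewrite Fx GRing.add0r -addSnnS; apply: IHn => m p xm mp py.
  by apply: FT; rewrite -?addSnnS // ltnW.
have [nT|Tn] := leqP n T; first by have := le x n.+1; nia.
rewrite (@big_cat_nat _ _ _ (x + T.+1)) ?leq_addr ?leq_add2l //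
  ?ltnS 1?ltnW //=.
rewrite [X in (_ + X)%R]big_nat_cond [X in (_ + X)%R]big1 ?GRing.addr0 //.
move=> m /andP[/andP[xm my] _]; have [//|Fm] := EM (F m = 0%R).
by have := FT x m (leqnn x) _ my Fx Fm; lia.
Qed.

(** * Weighted differentials and their integrals along words *)

Section PathCochains.
Variables (G : groupType) (L : Type) (H : L -> groupClosed G) (X : set G).

Local Notation letter := (letter (peripheral H) X).
Local Notation word := (rel_word H X).

Definition letter_set : set G := range (@lval G L H X).

Lemma letter_setV s : letter_set s -> letter_set s^-1.
Proof. by move=> [a _ <-]; exists (inv_letter a) => //; rewrite lval_inv. Qed.

Lemma letter_set_lval (a : letter) : letter_set (lval a).
Proof. by exists a. Qed.

Lemma letter_set_per l g : g \in H l -> letter_set g.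
Proof. by move=> gH; exists (@Per L (peripheral H) X l (exist _ g gH)). Qed.

Lemma ball_wval_in (Y : set G) (w : word) :
  (forall a, a \in w -> Y (lval a)) -> ball Y (size w) (wval w).
Proof.
elim: w => [|a w IHw] wY; first by rewrite wval_nil.
rewrite wval_cons; apply: (@ballM _ _ 1).
  exact/ball_gen/wY/mem_head.
by apply: IHw => b bw; apply: wY; rewrite inE bw orbT.
Qed.

Lemma ball_wval (w : word) : ball letter_set (size w) (wval w).
Proof. by apply: ball_wval_in => a _; exact: letter_set_lval. Qed.

Lemma ball_word n g : ball letter_set n g ->
  exists w : word, (size w <= n)%N /\ wval w = g.
Proof.
elim: n g => [|n IHn] g /=; first by move=> ->; exists [::]; rewrite wval_nil.
case=> [/IHn[w [wn wg]]|]; first by exists w; rewrite (leq_trans wn).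
move=> [x /IHn[w [wn <-]] [_ [a _ <-] <-]]; exists (w ++ [:: a]).
by rewrite size_cat addn1 ltnS wval_cat wval_cons wval_nil mulg1.
Qed.

Lemma generating_ball :
  rel_generating H X -> forall g, exists n, ball letter_set n g.
Proof.
move=> genG.
pose A : {pred G} := fun g => `[< exists n, ball letter_set n g >].
have A1 : 1 \in A by apply/asboolP; exists 0%N.
have AM : mulg_closed A.
  move=> x y /asboolP[m xm] /asboolP[n yn]; apply/asboolP; exists (m + n)%N.
  exact: ballM.
have AV : invg_closed A.
  move=> x /asboolP[m xm]; apply/asboolP; exists m.
  exact: (ballV letter_setV).
pose AC := isInvClosed.Build G A AV.
pose AO := isMul1Closed.Build G A A1.
pose AP := isMulClosed.Build G A AM.
pose B : groupClosed G := HB.pack A AC AO AP.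
move=> g; apply/asboolP; apply: (genG B) => x [Xx|[l _ xl]]; apply/asboolP.
  exists 1%N; apply: ball_gen.
  by exists (Gen _ (exist _ x (mem_set Xx) : X) true).
by exists 1%N; apply/ball_gen/letter_set_per/xl.
Qed.

Definition vertex (a : nat -> letter) (i : nat) : G := wval (mkseq a i).

Lemma vertexS a i : vertex a i.+1 = vertex a i * lval (a i).
Proof. by rewrite /vertex mkseqS -cats1 wval_cat wval_cons wval_nil mulg1. Qed.

Lemma vertexD a i m :
  vertex a (i + m) = vertex a i * wval [seq a t | t <- iota i m].
Proof. by rewrite /vertex /mkseq iotaD map_cat wval_cat. Qed.

Lemma integral_path E a i m :
  integral E (vertex a i) [seq a t | t <- iota i m] =
  (\sum_(i <= t < i + m) E (vertex a t) (a t))%R.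
Proof.
elim: m i => [|m IHm] i; first by rewrite addn0 big_geq.
by rewrite /= -vertexS IHm addSnnS [RHS]big_ltn // -addSnnS ltnS leq_addr.
Qed.

(** [choose] depends only on the predicate, so all points of a coset get the same representative. *)
Definition coset_rep (l : L) (y : G) : G :=
  choose [pred z | y^-1 * z \in H l] y.

Lemma coset_rep_in l y : y^-1 * coset_rep l y \in H l.
Proof.
have := @chooseP _ [pred z | y^-1 * z \in H l] y.
by rewrite /= mulVg gpred1; apply.
Qed.

Lemma coset_repM l y h : h \in H l -> coset_rep l (y * h) = coset_rep l y.
Proof.
move=> hH; rewrite /coset_rep.
have e : [pred z | (y * h)^-1 * z \in H l] =1 [pred z | y^-1 * z \in H l].
  by move=> z; rewrite /= invgM -mulgA gpredMl // gpredV.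
rewrite (eq_choose e); apply: choose_id; rewrite /= ?mulVg ?gpred1 //.
by rewrite mulKg.
Qed.

(* A point attached to the undirected edge, and for a peripheral edge to the
   whole coset, so that a weighted differential is still a cochain. *)
Definition anchor (y : G) (a : letter) : G :=
  match a with
  | Per l _ => coset_rep l y
  | Gen _ b => if b then y else y * lval a
  end.

Definition weighted_diff (psi f : G -> int) (y : G) (a : letter) : int :=
  (psi (anchor y a) * (f (y * lval a)%g - f y))%R.

Lemma weighted_diff_cochain psi f : cochain (weighted_diff psi f).
Proof.
split=> [y l h k|y x b]; rewrite /weighted_diff /=.
  rewrite coset_repM; last exact: (valP h).
  by rewrite lval_perM mulgA; ring.
rewrite lval_genN.
by case: b => /=; rewrite -?lval_genN /= ?lval_genN ?mulgK ?mulgVK; ring.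
Qed.

Hypothesis genS : forall g, exists n, ball letter_set n g.

Local Notation d := (dist letter_set).
Let triangle := dist_triangle genS.
Let dC := distC letter_setV genS.

Lemma dist_anchor y a : (d y (anchor y a) <= 1)%N.
Proof.
case: a => [l h|x []] /=; rewrite ?distxx ?dist_gen //.
  rewrite -[coset_rep l y](mulVKg y); apply: dist_gen.
  exact/letter_set_per/coset_rep_in.
exact: letter_set_lval.
Qed.

(** Truncated subtraction makes this vanish at distance [r] and beyond. *)
Definition bump (p : G) (r : nat) (z : G) : int := Posz (r - d p z).

(** Freezing the weight at [c] leaves an exact differential; the weight drifts by at most 1 per
    edge, so no edge errs by more than [s + size u]. *)
Lemma integral_bump_approx p r (f : G -> int) (c : int) (s : nat) y (u : word) :
  (forall z (a : letter), `|f (z * lval a)%g - f z| <= 1)%R ->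
  (`|bump p r y - c| <= s%:Z)%R ->
  (`|integral (weighted_diff (bump p r) f) y u - c * (f (y * wval u)%g - f y)|
     <= (size u * (s + size u))%N%:Z)%R.
Proof.
move=> f1; elim: u y s => [|a u IHu] y s ys /=.
  by rewrite wval_nil mulg1; nia.
have := IHu (y * lval a) s.+1.
rewrite mulg_wval_cons; set I := integral _ _ _.
have ya : (d y (y * lval a) <= 1)%N by exact/dist_gen/letter_set_lval.
have := triangle y p (y * lval a); have := triangle (y * lval a) p y.
rewrite (dC (y * lval a) y) => t1 t2.
have -> : (`|bump p r (y * lval a)%g - c| <= s.+1%:Z)%R.
  by move: ys t1 t2 ya; rewrite /bump; lia.
move=> /(_ isT); rewrite /weighted_diff.
have := triangle y p (anchor y a); have := triangle (anchor y a) p y.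
rewrite (dC (anchor y a) y) => t3 t4.
have ps : (`|bump p r (anchor y a) - c| <= s.+1%:Z)%R.
  by move: ys t3 t4 (dist_anchor y a); rewrite /bump; lia.
have := f1 y a.
move: ps; move: (bump p r _) (f (_ * wval u)) (f (y * _)) (f y) => b f2 f3 f4.
move=> ps ff J.
have : (`|(b - c) * (f3 - f4)| <= s.+1%:Z)%R.
  by rewrite Num.Theory.normrM; nia.
have -> : ((b * (f3 - f4) + I - c * (f2 - f4)) =
  (b - c) * (f3 - f4) + (I - c * (f2 - f3)))%R by ring.
nia.
Qed.

Lemma integral_bump_closed p r (f : G -> int) y (u : word) :
  (forall z (a : letter), `|f (z * lval a)%g - f z| <= 1)%R -> wval u = 1 ->
  (`|integral (weighted_diff (bump p r) f) y u| <= (size u * size u)%N%:Z)%R.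
Proof.
move=> f1 u1; have := @integral_bump_approx p r f (bump p r y) 0 y u f1.
by rewrite u1 mulg1 !GRing.subrr GRing.mulr0 GRing.subr0; apply.
Qed.

(** By the triangle inequality every vertex of the path is farther than [r] from [p], so every
    anchor is at distance at least [r], where the weight is zero. *)
Lemma integral_bump_eq0 p r (f : G -> int) y (u : word) :
  (2 * r + size u < d p y + d p (y * wval u))%N ->
  integral (weighted_diff (bump p r) f) y u = 0%R.
Proof.
elim: u y => [//|a u IHu] y /=; rewrite mulg_wval_cons => far.
have ya : (d y (y * lval a) <= 1)%N by exact/dist_gen/letter_set_lval.
have := triangle (y * lval a) p y; rewrite (dC (y * lval a) y) => t1.
rewrite IHu; last by lia.
have ball_u : (d (y * lval a) (y * lval a * wval u) <= size u)%N.
  by rewrite /dist mulKg; apply/word_length_le/ball_wval.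
have t2 := triangle (y * lval a) p (y * lval a * wval u).
have := triangle (anchor y a) p y; rewrite (dC (anchor y a) y) => t3.
have t4 := triangle y p (y * lval a).
have an := dist_anchor y a.
rewrite /weighted_diff /bump (_ : r - _ = 0)%N ?GRing.mul0r //; lia.
Qed.

Lemma dist_lipschitz p z (a : letter) :
  (`|Posz (d p (z * lval a)%g) - Posz (d p z)| <= 1)%R.
Proof.
have za : (d z (z * lval a) <= 1)%N by exact/dist_gen/letter_set_lval.
have := triangle z p (z * lval a); have := triangle (z * lval a) p z.
by rewrite (dC (z * lval a) z); lia.
Qed.

End PathCochains.

(** * Bounding the scale of closed local geodesics *)

Section LocalGeodesics.
Variables (G : groupType) (L : Type) (H : L -> groupClosed G) (X : set G).

Local Notation letter := (letter (peripheral H) X).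
Local Notation word := (rel_word H X).
Local Notation d := (dist (letter_set H X)).

Hypothesis genS : forall g, exists n, ball (letter_set H X) n g.

Let triangle := dist_triangle genS.
Let dC := distC (@letter_setV G L H X) genS.

Section Shortcut.
Variables (a : nat -> letter) (k q i D : nat).
Let P := vertex a.
Hypothesis geo : forall s t, (t <= k)%N -> d (P s) (P (s + t)) = t.
Hypothesis kq : (32 * q + 4 <= k)%N.
Hypothesis kD : (k < D)%N.
Hypothesis short : (d (P i) (P (i + D)) <= 8 * q)%N.
Hypothesis minD : forall s t, (k < t)%N -> (t < D)%N ->
  (8 * q < d (P s) (P (s + t)))%N.

(** An index gap above [k] would give a shortcut shorter than [D]; up to [k] the path is
    geodesic. *)
Lemma near_vertices s t : (s <= t)%N -> (t - s < D)%N ->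
  (d (P s) (P t) <= 8 * q)%N -> (d (P s) (P t) = t - s)%N.
Proof.
move=> st tsD; have := @geo s (t - s)%N; have := @minD s (t - s)%N.
by rewrite subnKC //; lia.
Qed.

Variable c : word.
Hypothesis c_short : (size c <= 8 * q)%N.
Hypothesis c_val : wval c = (P i)^-1 * P (i + D).

Let loop : word := [seq a t | t <- iota i D] ++ inv_word c.

Let phi m : G -> letter -> int :=
  weighted_diff (bump H X (P m) (2 * q)) (fun z => Posz (d (P (m - 2 * q)) z)).

(* Around [P m] the weight is 2q minus the distance to [P m], and [f] increases
   by 1 along each edge of the path, so the edges [m, m + q) contribute at
   least q each, and no edge contributes negatively. *)
Lemma integral_loop_ge m : (i + 8 * q < m)%N -> (m + 8 * q < i + D)%N ->
  (Posz (q * q) <= integral (phi m) (P i) loop)%R.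
Proof.
move=> im mD; rewrite /loop integral_cat -vertexD.
have far s : s = i \/ s = (i + D)%N -> (8 * q < d (P m) (P s))%N.
  case=> ->.
    by have := @near_vertices i m; rewrite dC; lia.
  by have := @near_vertices m (i + D); lia.
(* The chord misses the support: [4 * q] plus its length is at most [12 * q], while its ends are
   each farther than [8 * q] from [P m]. *)
rewrite [X in (_ + X)%R]integral_bump_eq0 //; last first.
  rewrite wval_inv c_val invgM invgK mulVKg size_rev size_map.
  by have := far i; have := far (i + D)%N; rewrite /P; lia.
rewrite GRing.addr0 integral_path.
have term t : (i <= t)%N -> (t < i + D)%N ->
    (0 <= phi m (P t) (a t))%R /\
    ((m <= t)%N -> (t < m + q)%N -> (Posz q <= phi m (P t) (a t))%R).
  move=> it tD; rewrite /phi /weighted_diff -vertexS -/P /bump.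
  have an := dist_anchor (P t) (a t).
  have t1 := triangle (anchor (P t) (a t)) (P m) (P t).
  have t2 := triangle (P t) (P m) (anchor (P t) (a t)).
  rewrite (dC (anchor _ _)) in t1.
  have [far_t|near_t] := ltnP (2 * q) (d (P m) (P t)).
    rewrite (_ : 2 * q - _ = 0)%N ?GRing.mul0r; last by lia.
    split=> // mt tq; have := @geo m (t - m)%N.
    by rewrite subnKC //; lia.
  (* The two indices differ by at most [4 * q + 1], which is at most [k]. *)
  have fP s : (m <= s + 2 * q)%N -> (s <= m + 2 * q + 1)%N ->
      d (P (m - 2 * q)) (P s) = (s - (m - 2 * q))%N.
    move=> ms sm; have := @geo (m - 2 * q)%N (s - (m - 2 * q))%N.
    by rewrite subnKC; [apply; lia | lia].
  have mt2 : (m <= t + 2 * q)%N /\ (t <= m + 2 * q)%N.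
    have := @near_vertices m t; have := @near_vertices t m.
    by rewrite (dC (P t)); lia.
  rewrite !fP; [|lia..].
  rewrite (_ : (_ - _)%R = 1%R) ?GRing.mulr1; last by lia.
  (* The anchor may be one step farther than [P t], hence at distance at most [(q - 1) + 1], which
     leaves weight at least [q]. *)
  split=> // mt tq; have := @geo m (t - m)%N; rewrite subnKC //; lia.
rewrite (@big_cat_nat _ _ _ m) /=; [|lia..].
rewrite (@big_cat_nat _ _ _ (m + q) m) /=; [|lia..].
have sum0 s t : (i <= s)%N -> (t <= i + D)%N ->
    (0 <= \sum_(s <= u < t) phi m (P u) (a u))%R.
  move=> si tD; rewrite big_nat_cond; apply: Num.Theory.sumr_ge0 => u.
  by move=> /andP[/andP[su ut] _]; apply: (proj1 (term u _ _)); lia.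
have mid : (Posz (q * q) <= \sum_(m <= u < m + q) phi m (P u) (a u))%R.
  have -> : Posz (q * q) = (\sum_(m <= u < m + q) Posz q)%R.
    by rewrite GRing.sumr_const_nat addKn -[Posz q]natz -GRing.mulrnA natz.
  rewrite big_nat_cond [X in (_ <= X)%R]big_nat_cond.
  apply: Num.Theory.ler_sum => u /andP[/andP[mu uq] _].
  by apply: (proj2 (term u _ _)); lia.
apply: (Order.POrderTheory.le_trans mid).
rewrite GRing.addrCA Num.Theory.lerDl.
by apply: Num.Theory.addr_ge0; apply: sum0; lia.
Qed.

Variables (R : set word) (M C : nat).
Hypothesis R1 : forall r, R r -> wval r = 1.
Hypothesis RM : forall r, R r -> (size r <= M)%N.
Hypothesis linear_area : forall w, wval w = 1 -> rel_area_le R w (C * size w).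

(** The integrals of the [phi m] sum to at least [D * q ^ 2 / 2]. Each of at most [2 * C * D]
    relators meets at most [6 * q + 1] of the supports and contributes at most [M ^ 2] to each. *)
Lemma shortcut_bound : (M <= q)%N -> (q <= 28 * C * M ^ 2)%N.
Proof.
move=> Mq.
have loop1 : wval loop = 1.
  apply: (mulgI (P i)); rewrite wval_cat mulgA -vertexD wval_inv c_val.
  by rewrite invgM invgK mulVKg mulg1.
have [s [ss sR sE]] := area_decomposition R1 (linear_area loop1).
pose lo := (i + 8 * q).+1; pose hi := (i + D - 8 * q)%N.
have lower : (Posz ((hi - lo) * (q * q)) <=
    \sum_(lo <= m < hi) integral (phi m) (P i) loop)%R.
  have -> : Posz ((hi - lo) * (q * q)) = (\sum_(lo <= m < hi) Posz (q * q))%R.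
    rewrite GRing.sumr_const_nat -[Posz (q * q)]natz -GRing.mulrnA natz.
    by rewrite mulnC.
  rewrite big_nat_cond [X in (_ <= X)%R]big_nat_cond.
  apply: Num.Theory.ler_sum => m /andP[/andP[lm mh] _].
  by apply: integral_loop_ge; rewrite /lo /hi in lm mh *; lia.
(* A relator meets the support of [phi m] only if it comes near [P m], which
   confines [m] to an interval of length [6 * q]. *)
have cell p : p \in s -> (\sum_(lo <= m < hi)
    integral (phi m) (P i * p.1)%g p.2 <= Posz (M ^ 2 * (6 * q).+1))%R.
  move=> /sR Rp; apply: sum_window.
    move=> m; have := @integral_bump_closed _ _ _ _ genS (P m) (2 * q)
      (fun z => Posz (d (P (m - 2 * q)) z)) (P i * p.1) p.2
      (dist_lipschitz genS _) (R1 Rp).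
    have := RM Rp; rewrite -/(phi m) => pM.
    have : (size p.2 * size p.2 <= M ^ 2)%N by rewrite -mulnn leq_mul.
    lia.
  (* Farther away the relator, of length at most [M <= q], misses the support, because
     [4 * q + M < 2 * (3 * q + 1)]. *)
  have near m : integral (phi m) (P i * p.1)%g p.2 <> 0%R ->
      (d (P m) (P i * p.1) <= 3 * q)%N.
    move=> nz; rewrite leqNgt; apply/negP => far; apply: nz.
    apply: (integral_bump_eq0 genS); rewrite (R1 Rp) mulg1.
    by have := RM Rp; lia.
  move=> m n lm mn nh /near dm /near dn.
  have t := triangle (P i * p.1) (P m) (P n); rewrite (dC (_ * _)) in t.
  by have := @near_vertices m n; rewrite /lo /hi in lm nh; lia.
have {}cell : (\sum_(lo <= m < hi) integral (phi m) (P i) loop <=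
    Posz (size s * (M ^ 2 * (6 * q).+1)))%R.
  rewrite (eq_bigr (fun m =>
    \sum_(p <- s) integral (phi m) (P i * p.1)%g p.2)%R); last first.
    by move=> m _; apply: sE; exact: weighted_diff_cochain.
  rewrite exchange_big /=.
  have -> : Posz (size s * (M ^ 2 * (6 * q).+1)) =
      (\sum_(p <- s) Posz (M ^ 2 * (6 * q).+1))%R.
    rewrite big_const_seq count_predT.
    by elim: (size s) => [//|n IHn]; rewrite iterS -IHn; lia.
  rewrite big_seq [X in (_ <= X)%R]big_seq.
  exact: Num.Theory.ler_sum.
have {lower cell} main : ((hi - lo) * (q * q) <=
    size s * (M ^ 2 * (6 * q).+1))%N.
  by have := Order.POrderTheory.le_trans lower cell; lia.
have sizes : (size s <= C * (2 * D))%N.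
  apply: leq_trans ss _; rewrite leq_mul2l; apply/orP; right.
  by rewrite size_cat size_rev !size_map size_iota; lia.
have [->//|q0] := posnP q.
(* Since [D > 32 * q + 4], dropping about [8 * q] indices at each end keeps at least half of
   them. *)
have D2 : (D <= 2 * (hi - lo))%N by rewrite /lo /hi; lia.
have m1 : (D * (q * q) <= 2 * ((hi - lo) * (q * q)))%N.
  by rewrite [leqRHS]mulnA leq_mul.
have m2 : (size s * (M ^ 2 * (6 * q).+1) <= C * (2 * D) * (M ^ 2 * (7 * q)))%N.
  by apply: leq_mul => //; rewrite leq_mul2l; apply/orP; right; lia.
have : (D * q * q <= D * q * (28 * C * M ^ 2))%N by lia.
by rewrite leq_pmul2l // muln_gt0 q0 andbT; lia.
Qed.

End Shortcut.

(** The whole closed path is itself a shortcut, so a shortest one exists. *)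
Lemma local_geodesic_bound (R : set word) (M C : nat) (a : nat -> letter) k N :
  (forall r, R r -> wval r = 1) -> (forall r, R r -> (size r <= M)%N) ->
  (forall w, wval w = 1 -> rel_area_le R w (C * size w)) ->
  (forall s t, (t <= k)%N -> d (vertex a s) (vertex a (s + t)) = t) ->
  (k < N)%N -> vertex a N = 1 ->
  (k < 32 * (M + 28 * C * M ^ 2).+1 + 4)%N.
Proof.
move=> R1 RM area geo kN aN; rewrite ltnNge; apply/negP.
(* This value exceeds both [M] and the bound of [shortcut_bound], which yields the contradiction. *)
set q := (_ + _).+1 => kq.
pose short D := `[< exists i,
  (k < D)%N /\ (d (vertex a i) (vertex a (i + D)) <= 8 * q)%N >].
have exD : exists D, short D.
  exists N; apply/asboolP; exists 0%N; split=> //.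
  by rewrite add0n aN /vertex wval_nil distxx.
case: (ex_minnP exD) => D /asboolP[i [kD iD]] minD.
have minD' s t : (k < t)%N -> (t < D)%N ->
    (8 * q < d (vertex a s) (vertex a (s + t)))%N.
  move=> kt tD; rewrite ltnNge; apply/negP => st.
  by have /minD : short t by [apply/asboolP; exists s]; rewrite leqNgt tD.
have [c [cs cv]] :=
  ball_word (ball_len genS ((vertex a i)^-1 * vertex a (i + D))).
have := shortcut_bound geo kq kD iD minD' (leq_trans cs iD) cv R1 RM area.
by rewrite /q; lia.
Qed.

End LocalGeodesics.

Lemma torsion_free_closed (G : groupType) (A : groupClosed G) :
  torsion_free (subgroup_type A) ->
  forall x n, x \in A -> (0 < n)%N -> x ^+ n = 1 -> x = 1.
Proof.
move=> tfA x n xA n0 xn.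
pose y : subgroup_type A := Sub x xA.
have valX m : val (y ^+ m) = x ^+ m.
  by elim: m => [|m IHm]; rewrite ?expgS -?IHm.
have : y = 1 by apply: tfA n0 _; apply: val_inj; rewrite valX.
by move/(congr1 val).
Qed.

(** * Periodic paths of torsion elements *)

Section PeriodicPaths.
Variables (G : groupType) (L : Type) (H : L -> groupClosed G) (X : set G).

Local Notation letter := (letter (peripheral H) X).
Local Notation word := (rel_word H X).
Local Notation d := (dist (letter_set H X)).
Local Notation len := (word_length (letter_set H X) 0).

Hypothesis genS : forall g, exists n, ball (letter_set H X) n g.
Hypothesis tfH : forall l, torsion_free (subgroup_type (H l)).

Let triangle := dist_triangle genS.
Let dC := distC (@letter_setV G L H X) genS.

Variables (a0 : letter) (w0 : word) (n : nat).
Let w : word := a0 :: w0.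
Let k := size w.
Let gam := wval w.

Hypothesis n_gt1 : (1 < n)%N.
Hypothesis gam_n : gam ^+ n = 1.
Hypothesis gam_order : forall m, (0 < m)%N -> (m < n)%N -> gam ^+ m <> 1.
(* Minimality is required over conjugates of all nontrivial powers, not only of
   [gam]; this is what makes peripheral letters isolated. *)
Hypothesis gam_min : forall m t, gam ^+ m <> 1 -> (k <= len ((gam ^+ m) ^ t))%N.

Definition periodic (i : nat) : letter := nth a0 w (i %% k).
Local Notation a := periodic.
Let P := vertex a.

Lemma vertex_period m i : P (m * k + i) = gam ^+ m * P i.
Proof.
have ak : mkseq a k = w.
  rewrite -[RHS](mkseq_nth a0 w); apply/eq_in_map => t.
  by rewrite mem_iota /a => /andP[_ tk]; rewrite /periodic modn_small.
elim: m => [|m IHm]; first by rewrite mul0n mul1g.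
rewrite mulSn -addnA expgS -mulgA -IHm /P {1}/vertex /mkseq iotaD map_cat.
rewrite wval_cat -/(mkseq a k) ak add0n -[k in iota k]addn0 iotaDl -map_comp.
by congr (_ * wval _); apply: eq_map => t /=; rewrite /periodic modnDl.
Qed.

Lemma vertex_closed : P (n * k) = 1.
Proof.
by rewrite -[(n * k)%N]addn0 vertex_period gam_n mul1g /P /vertex wval_nil.
Qed.

(** Vertices [k] steps apart differ by a conjugate of [gam], so they are at distance at least [k];
    shorter subpaths inherit geodesicity. *)
Lemma periodic_geodesic s t : (t <= k)%N -> d (P s) (P (s + t)) = t.
Proof.
move=> tk.
have le u v : (d (P u) (P (u + v)) <= v)%N.
  rewrite /dist {2}/P vertexD mulKg; apply: word_length_le.
  by have := ball_wval [seq a x | x <- iota u v]; rewrite size_map size_iota.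
have kd : (k <= d (P s) (P (s + k)))%N.
  rewrite /dist addnC -{2}[k]mul1n vertex_period.
  rewrite -[_^-1 * _]/((gam ^+ 1) ^ P s); apply: gam_min; exact: gam_order.
have := le s t; have := le (s + t)%N (k - t)%N; rewrite -addnA subnKC //.
by have := triangle (P (s + t)) (P s) (P (s + k)); lia.
Qed.

(* Otherwise, with j - i = Qk + s, a conjugate of gam^Q is the product of an
   element of [H l] and of a geodesic of length s - 1, which contradicts
   [gam_min], or else gam^Q itself is conjugate into the torsion-free [H l]. *)
Lemma isolated_components i j l (h h' : peripheral H l) :
  (i < j)%N -> (j < n * k)%N ->
  a i = Per X h -> a j = Per X h' -> (P i)^-1 * P j \notin H l.
Proof.
move=> ij jN ai aj; apply/negP => ijH.
pose Q := ((j - i) %/ k)%N; pose s := ((j - i) %% k)%N.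
have sk : (s < k)%N by rewrite ltn_mod.
have jE : j = (Q * k + (i + s))%N.
  by have := divn_eq (j - i) k; rewrite /Q /s; lia.
have Qn : (Q < n)%N by rewrite -(ltn_pmul2r (isT : 0 < k)%N); lia.
have Pj : P j = gam ^+ Q * P (i + s) by rewrite jE vertex_period.
have hH (g : peripheral H l) : lval (Per X g) \in H l by exact: (valP g).
have H_len g : g \in H l -> (len g <= 1)%N.
  move=> gH; apply: word_length_le; apply: ball_gen.
  exact: letter_set_per gH.
have [s0|s0] := posnP s.
  have Q0 : (0 < Q)%N by case: posnP jE => // ->; lia.
  apply: (gam_order Q0 Qn); apply: (@conjg_inj _ (P i)); rewrite conj1g.
  apply: (torsion_free_closed (@tfH l) _ (ltnW n_gt1)).
    by move: ijH; rewrite Pj s0 addn0.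
  by rewrite -conjXg expgnAC gam_n expg1n conj1g.
(* If [Q = 0], both letters lie on a geodesic of [s.+1 >= 2] edges whose ends would differ by an
   element of [H l]. *)
have [Q0|Q0] := posnP Q.
  have js : j = (i + s)%N by rewrite jE Q0.
  have := @periodic_geodesic i s.+1 sk.
  rewrite addnS -js /dist {2}/P vertexS aj mulgA => e.
  by have := H_len _ (gpredM _ _ ijH (hH h')); rewrite e; lia.
(* Conjugating by [P i.+1] absorbs the letter at [i] into [H l], so the length is at most
   [1 + (s - 1) < k]. *)
have := @gam_min Q (P i.+1) (gam_order Q0 Qn); apply/negP; rewrite -ltnNge.
rewrite (_ : _ ^ _ = (P i.+1)^-1 * P j * ((P (i + s))^-1 * P i.+1)); last first.
  by rewrite Pj conjgE !mulgA mulgK.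
apply: leq_ltn_trans (lenM genS _ _) _.
have l1 : (len ((P i.+1)^-1 * P j) <= 1)%N.
  by apply: H_len; rewrite /P vertexS ai invgM -mulgA gpredM ?gpredV.
have := dC (P (i + s)) (P i.+1); rewrite {1}/dist => ->.
have := @periodic_geodesic i.+1 s.-1; rewrite addSnnS prednK //; lia.
Qed.

Variables (Omega : set G) (B : nat).
Hypothesis OmegaV : forall s, Omega s -> Omega s^-1.

Local Notation olen := (word_length Omega B).

Let has_type (l : L) (b : letter) : bool :=
  `[< exists h : peripheral H l, b = Per X h >].

(** [find] returns [n * k] when the path has no edge in the coset of [y]. *)
Let component (l : L) (y : G) : nat :=
  find (fun m => has_type l (a m) && ((P m)^-1 * y \in H l)) (iota 0 (n * k)).

Let component_length (l : L) (y : G) : int :=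
  if (component l y < n * k)%N then Posz (olen ((P (component l y))^-1 * y))
  else 0%R.

(* On the coset of [H l] met by the closed path at its m-th edge this is the
   differential of the [Omega]-length measured from [P m]. *)
Definition component_cochain (y : G) (b : letter) : int :=
  match b with
  | Per l h => (component_length l (y * lval b)%g - component_length l y)%R
  | Gen _ _ => 0%R
  end.

Lemma component_cochainP : cochain component_cochain.
Proof.
split=> [y l h h'|y x b] /=; last by rewrite GRing.addr0.
by rewrite lval_perM mulgA; ring.
Qed.

Let componentM l y h : h \in H l -> component l (y * h) = component l y.
Proof.
by move=> hH; apply: eq_find => m; rewrite mulgA (gpredMr _ hH).
Qed.

(** Both ends of the edge are measured from the same vertex, and a letter of [Omega] changes [olen]
    by at most 1, junk value included. *)
Lemma component_cochain_le1 y b : Omega (lval b) ->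
  (`|component_cochain y b| <= 1)%R.
Proof.
case: b => [l h|//] Oh; rewrite /component_cochain /component_length.
rewrite componentM; last exact: (valP h).
by case: ifP => // _; rewrite mulgA; exact: word_length_lipschitz.
Qed.

Definition peripheral_length (b : letter) : nat :=
  if b is Per l h then olen (lval b) else 0.

(** By isolation [t] is the first index in its coset, so lengths are measured from [P t] itself. *)
Lemma component_cochain_path t : (t < n * k)%N ->
  component_cochain (P t) (a t) = peripheral_length (a t).
Proof.
move=> tN; case at_ : (a t) => [l h|//].
have ct : component l (P t) = t.
  have tP : has_type l (a t) && ((P t)^-1 * P t \in H l).
    by rewrite mulVg gpred1 andbT; apply/asboolP; exists h.
  have [lt|gt|//] := ltngtP (component l (P t)) t; last first.
    by have := before_find 0%N gt; rewrite nth_iota // add0n tP.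
  have : has (fun m => has_type l (a m) && ((P m)^-1 * P t \in H l))
      (iota 0 (n * k)).
    by apply/hasP; exists t => //; rewrite mem_iota add0n.
  move=> /(nth_find 0%N); rewrite -/(component l (P t)).
  rewrite nth_iota ?add0n ?(ltn_trans lt tN) //.
  move=> /andP[/asboolP[h' ah'] inH].
  by have := isolated_components lt tN ah' at_; rewrite inH.
rewrite /component_cochain /component_length.
rewrite componentM ?ct ?tN; last exact: (valP h).
by rewrite mulKg mulVg word_length1 GRing.subr0.
Qed.

Variables (R : set word) (M C : nat).
Hypothesis R1 : forall r, R r -> wval r = 1.
Hypothesis RM : forall r, R r -> (size r <= M)%N.
Hypothesis linear_area : forall v, wval v = 1 -> rel_area_le R v (C * size v).
Hypothesis R_Omega : forall r b, R r -> b \in r -> Omega (lval b).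

Lemma sum_peripheral_length_le :
  (\sum_(0 <= t < n * k) peripheral_length (a t) <= C * (n * k) * M)%N.
Proof.
have loop1 : wval (mkseq a (n * k)) = 1 by exact: vertex_closed.
have [s [ss sR sE]] := area_decomposition R1 (linear_area loop1).
have := sE _ 1 component_cochainP.
have -> : integral component_cochain 1 (mkseq a (n * k)) =
    Posz (\sum_(0 <= t < n * k) peripheral_length (a t)).
  have := integral_path component_cochain a 0 (n * k).
  rewrite /vertex wval_nil add0n /mkseq => ->.
  rewrite (big_morph Posz PoszD (erefl : Posz 0 = 0%R)).
  by apply: eq_big_nat => t /andP[_ tN]; exact: component_cochain_path.
have le y (u : word) : (forall b, b \in u -> Omega (lval b)) ->
    (integral component_cochain y u <= Posz (size u))%R.
  elim: u y => [//|b u IHu] y uO /=.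
  rewrite -add1n PoszD; apply: Num.Theory.lerD; last first.
    by apply: IHu => c cu; apply: uO; rewrite inE cu orbT.
  apply: Order.POrderTheory.le_trans (Num.Theory.ler_norm _) _.
  by apply/component_cochain_le1/uO; exact: mem_head.
have cells : (\sum_(p <- s) integral component_cochain (1 * p.1)%g p.2 <=
    Posz (size s * M))%R.
  have -> : Posz (size s * M) = (\sum_(p <- s) Posz M)%R.
    rewrite big_const_seq count_predT.
    by elim: (size s) => [//|m IHm]; rewrite iterS -IHm; lia.
  rewrite big_seq [X in (_ <= X)%R]big_seq; apply: Num.Theory.ler_sum => p ps.
  apply: (Order.POrderTheory.le_trans (le _ _ _)).
    by move=> b; exact/R_Omega/sR.
  by rewrite lez_nat; exact: RM (sR _ ps).
move=> e; rewrite -e in cells; rewrite size_mkseq in ss.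
by apply: leq_trans (_ : size s * M <= _)%N; [lia | rewrite leq_mul2r ss orbT].
Qed.

(** The letter recurs at every index [m * k + i], hence [n] times in the loop. *)
Lemma peripheral_length_le i : (i < k)%N ->
  (peripheral_length (a i) <= C * k * M)%N.
Proof.
move=> ik; rewrite -(@leq_pmul2l n) ?(ltnW n_gt1) //.
rewrite !mulnA (mulnC n C) -(mulnA C n k).
apply: leq_trans sum_peripheral_length_le.
have ai m : a (m * k + i) = a i by rewrite /periodic modnMDl.
elim: (n) => [//|m IHm].
rewrite mulSnr mulSnr (@big_cat_nat _ _ _ (m * k)) ?leq_addr //=.
rewrite leq_add // -(ai m).
rewrite (@big_cat_nat _ _ _ (m * k + i)) ?leq_addr ?leq_add2l ?(ltnW ik) //=.
by rewrite [X in (_ <= _ + X)%N]big_ltn ?ltn_add2l // addnCA leq_addr.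
Qed.

End PeriodicPaths.

(** * A finite set met by the powers of all torsion elements, up to conjugacy *)

Section TorsionClasses.
Variables (G : groupType) (L : Type) (H : L -> groupClosed G) (X : set G).

Local Notation letter := (letter (peripheral H) X).
Local Notation word := (rel_word H X).
Local Notation len := (word_length (letter_set H X) 0).

Hypothesis genS : forall g, exists n, ball (letter_set H X) n g.
Hypothesis tfH : forall l, torsion_free (subgroup_type (H l)).
Hypothesis finX : finite_set X.

Variables (R : set word) (C : nat).
Hypothesis finR : finite_set R.
Hypothesis R1 : forall r, R r -> wval r = 1.
Hypothesis RV : forall r, R r -> R (inv_word r).
Hypothesis linear_area : forall w, wval w = 1 -> rel_area_le R w (C * size w).

Lemma torsion_classes_finite : exists T : set G,
  [/\ finite_set T, ~ T 1 & forall g n, (0 < n)%N -> g ^+ n = 1 -> g <> 1 ->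
      exists m t, T ((g ^+ m) ^ t)].
Proof.
have /finite_seqP[rs RE] := finR.
pose M := \max_(r <- rs) size r.
have RM r : R r -> (size r <= M)%N.
  rewrite RE => rR.
  exact: (@leq_bigmax_seq _ rs xpredT (fun r : word => size r)).
pose Omega : set G := [set` map (@lval G L H X) (flatten rs)].
have R_Omega r b : R r -> b \in r -> Omega (lval b).
  by rewrite RE => rR br; apply: map_f; apply/flattenP; exists r.
have OmegaV s : Omega s -> Omega s^-1.
  move=> /mapP[b /flattenP[r rR br] ->]; rewrite -lval_inv.
  apply: (R_Omega (inv_word r)); first by apply: RV; rewrite RE.
  by rewrite mem_rev map_f.
(* [K] is the bound on the length of [gam]. The junk value [B] is one more than the bound on
   peripheral letters, so every such letter has a genuine [Omega]-length. *)
pose K := (32 * (M + 28 * C * M ^ 2).+1 + 4)%N; pose B := (C * K * M).+1.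
pose Y : set G := ball Omega B `|` (X `|` inv @` X).
have finY : finite_set Y.
  rewrite finite_setU; split; first by apply: finite_ball; exact: finite_seq.
  by rewrite finite_setU; split=> //; exact: finite_image.
exists (ball Y K `\ 1); split; first by apply: finite_setD; exact: finite_ball.
  by case=> _; apply.
move=> g n n_gt0 gn g1.
pose reach k := `[< exists m t, g ^+ m <> 1 /\ len ((g ^+ m) ^ t) = k >].
have exk : exists k, reach k.
  by exists (len (g ^+ 1 ^ 1)); apply/asboolP; exists 1%N, 1.
case: (ex_minnP exk) => k /asboolP[m [t [gm1 lenk]]] k_min.
exists m, t; set gam := (g ^+ m) ^ t in lenk *.
have gam1 : gam <> 1 by move/eqP; rewrite conjg_eq1 => /eqP.
split=> //.
have [w [wk wgam]] := ball_word (ball_len genS gam); rewrite lenk in wk.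
have kw : size w = k.
  apply/eqP; rewrite eqn_leq wk -lenk -wgam.
  by apply: word_length_le; exact: ball_wval.
case: w wgam kw {wk} => [|a0 w0] wgam kw.
  by case: gam1; rewrite -wgam wval_nil.
have exn : exists i, (0 < i)%N && (gam ^+ i == 1).
  exists n; rewrite n_gt0 /gam -conjXg expgnAC gn expg1n conj1g.
  exact: eqxx.
(* [p] is the exact order of [gam]. *)
case: (ex_minnP exn) => p /andP[p_gt0 /eqP gam_p] p_min.
have p_gt1 : (1 < p)%N by case: p p_gt0 gam_p {p_min} => [|[]].
have order i : (0 < i)%N -> (i < p)%N -> gam ^+ i <> 1.
  move=> i0 ip gi; have := p_min i; rewrite i0 gi eqxx => /(_ isT).
  by rewrite leqNgt ip.
have minimal i u : gam ^+ i <> 1 -> (size (a0 :: w0) <= len ((gam ^+ i) ^ u))%N.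
  move=> gi; rewrite kw; apply: k_min; apply/asboolP; exists (m * i)%N, (t * u).
  have e : (gam ^+ i) ^ u = (g ^+ (m * i)) ^ (t * u).
    by rewrite expgnA conjgM [in RHS]conjXg.
  split; last by rewrite e.
  by move=> gmi; apply: gi; apply: (@conjg_inj _ u); rewrite e gmi !conj1g.
rewrite -wgam in gam_p order minimal *.
have kK : (size (a0 :: w0) < K)%N.
  apply: (local_geodesic_bound genS R1 RM linear_area).
  - exact: (periodic_geodesic genS p_gt1 order minimal).
  - exact: ltn_Pmull p_gt1 _.
  - exact: (vertex_closed gam_p).
apply: (ball_le (ltnW kK)); apply: ball_wval_in => b bw.
have bi : periodic a0 w0 (index b (a0 :: w0)) = b.
  by rewrite /periodic modn_small ?index_mem ?nth_index.
have := peripheral_length_le genS tfH p_gt1 gam_p order minimal B OmegaV R1 RM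
  linear_area R_Omega (i := index b (a0 :: w0)).
rewrite index_mem bi => /(_ bw).
case: b {bw bi} => [l h|x c] /= bK.
  left; have lB : (word_length Omega B (lval (Per X h)) < B)%N.
    by rewrite ltnS (leq_trans bK) // leq_mul2r leq_mul2l (ltnW kK) !orbT.
  exact: (ball_le (ltnW lB)) (word_length_lt lB).
right; have Xx : X (val x) by exact: set_valP.
by case: c {bK}; [left | right; exists (val x)].
Qed.

End TorsionClasses.

(** * Finite quotients and torsion-free kernels *)

Lemma residually_finite_separates (G : groupType) (s : seq G) :
  residually_finite G -> (forall g, g \in s -> g <> 1) ->
  exists (Q : finGroupType) (phi : {multiplicative G -> Q}),
    forall g, g \in s -> phi g <> 1.
Proof.
move=> rfG; elim: s => [|g s IHs] s1.
  pose one := fun _ : G => (1 : {perm unit}).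
  pose oneM := isMultiplicative.Build _ _ one (fun _ _ => esym (mulg1 1)).
  by exists {perm unit}, (HB.pack one oneM : {multiplicative G -> {perm unit}}).
have [|Q [phi phiP]] := IHs.
  by move=> h hs; apply: s1; rewrite inE hs orbT.
have [Q' [psi psi_g]] := rfG g (s1 g (mem_head _ _)).
(* The product of the two quotients separates [g] together with all of [s]. *)
pose pair := fun x : G => (phi x, psi x) : (Q * Q')%type.
have pairM : {morph pair : x y / x * y} by move=> x y; rewrite /pair !gmulfM.
pose pairMult := isMultiplicative.Build _ _ pair pairM.
exists (Q * Q')%type, (HB.pack pair pairMult : {multiplicative G -> Q * Q'}).
move=> h; rewrite inE => /orP[/eqP ->|/phiP nh] [eh eh'].
  exact: psi_g.
exact: nh.
Qed.

Lemma virtually_torsion_free_of_torsion_classes (G : groupType) (T : set G) :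
  residually_finite G -> finite_set T -> ~ T 1 ->
  (forall g n, (0 < n)%N -> g ^+ n = 1 -> g <> 1 ->
     exists m t, T ((g ^+ m) ^ t)) ->
  virtually_torsion_free G.
Proof.
move=> rfG /finite_seqP[s Ts] T1 torsT.
have [|Q [phi phiP]] := @residually_finite_separates G s rfG.
  by move=> g gs g1; apply: T1; rewrite Ts -g1.
have phi1 : phi 1 = 1 by apply: (mulgI (phi 1)); rewrite mulg1 -gmulfM mulg1.
have phiV x : phi x^-1 = (phi x)^-1.
  by apply: (mulgI (phi x)); rewrite -gmulfM !mulgV.
pose A : {pred G} := fun g => phi g == 1.
have A1 : 1 \in A by apply/eqP.
have AM : mulg_closed A.
  by move=> x y /eqP x1 /eqP y1; apply/eqP; rewrite gmulfM x1 y1 mulg1.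
have AV : invg_closed A by move=> x /eqP x1; apply/eqP; rewrite phiV x1 invg1.
pose AC := isInvClosed.Build G A AV.
pose AO := isMul1Closed.Build G A A1.
pose AP := isMulClosed.Build G A AM.
pose B : groupClosed G := HB.pack A AC AO AP.
exists B; split.
  (* Left cosets of the kernel are fibers of [phi], hence finitely many. *)
  pose fiber (q : Q) : set G := [set x | phi x = q].
  apply: (@sub_finite_set _ _ (range fiber)); last exact: finite_image.
  move=> _ [g _ <-]; exists (phi g) => //; apply/seteqP; split=> [x /= xg|x].
    exists (g^-1 * x); last by rewrite mulVKg.
    by apply/eqP; rewrite gmulfM phiV xg mulVg.
  by case=> a /eqP a1 <-; rewrite /fiber /= gmulfM a1 mulg1.
move=> [g gB] n n0 gn; apply: val_inj => /=.
have gn' : g ^+ n = 1.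
  have valX m : val ((Sub g gB : subgroup_type B) ^+ m) = g ^+ m.
    by elim: m => [|m IHm]; rewrite ?expgS -?IHm.
  by rewrite -valX [_ ^+ n]gn.
have [//|g1] := EM (g = 1).
have [m [t Tg]] := torsT g n n0 gn' g1; exfalso.
apply: (phiP ((g ^+ m) ^ t)); first by rewrite Ts in Tg.
have gA : phi g = 1 by exact/eqP.
have phiX i : phi (g ^+ i) = 1.
  by elim: i => [|i IHi]; rewrite ?expgS ?gmulfM ?gA ?IHi ?mulg1.
by rewrite conjgE !gmulfM phiV phiX mul1g mulVg.
Qed.

(** Deleting identity letters makes any word admissible without lengthening it or changing its class
    in F. *)
Lemma linear_area_words (G : groupType) (L : Type) (H : L -> groupClosed G)
    (X : set G) (R : set (rel_word H X)) (f : nat -> nat) (C : nat) :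
  rel_isoperimetric R f -> (forall n, (f n <= C * n)%N) ->
  forall w, wval w = 1 -> rel_area_le R w (C * size w).
Proof.
move=> isoR fC w w1.
pose nontriv (a : letter (peripheral H) X) :=
  if a is Per l h then h != 1 else true.
have cong : word_cong w (filter nontriv w).
  elim: w {w1} => [|a w IHw] /=; first exact: cong_refl.
  have : word_cong (a :: w) (a :: filter nontriv w).
    exact: (cong_cat (cong_refl [:: a]) IHw).
  case: a => [l h|x b] //=; have [->|//] := eqVneq h 1.
  move=> /= /cong_trans; apply.
  exact: (cong_cat (@cong_one _ (peripheral H) X l)
    (cong_refl (filter nontriv w))).
have [|||s [ss sR sw]] := isoR (size w) (filter nontriv w).
- by move=> l h; rewrite mem_filter => /andP[/eqP].
- by rewrite size_filter count_size.
- by rewrite canonical_epiE -(wval_cong cong).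
exists s; split=> //; first exact: leq_trans ss (fC _).
by rewrite -sw; apply/word_classP.
Qed.

Theorem corollary1p13 (G : groupType) (L : Type) (H : L -> groupClosed G) :
  relatively_hyperbolic H ->
  residually_finite G ->
  (forall l : L, torsion_free (subgroup_type (H l))) ->
  virtually_torsion_free G.
Proof.
move=> [X [R [[finX genX finR [_ _ RV kerR]] [f [[isoR _] [C fC]]]]]] rfG tfH.
have R1 r : R r -> wval r = 1.
  move=> Rr; rewrite -canonical_epiE.
  suff : normal_closure (@rel_class G L H X @` R) (rel_class r) by rewrite kerR.
  by move=> N RN _; apply: RN; exists r.
have [T [finT T1 torsT]] := torsion_classes_finite (generating_ball genX) tfH
  finX finR R1 RV (linear_area_words isoR fC).
exact: virtually_torsion_free_of_torsion_classes rfG finT T1 torsT.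
Qed.
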